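(* Let $X$ be a smooth compact variety over $\mathbb{C}$, let $\mathscr{E}\to X$ be a vector bundle of rank $r>0$ whose Chern roots are not all zero, and let $\pi:\mathbb{P}(\mathscr{E})\to X$ be the projective bundle of lines in $\mathscr{E}$, with $H=c_1(\mathscr{O}(1))\in A_*\mathbb{P}(\mathscr{E})$. Let $L_1,\ldots,L_m$ be the distinct non-zero Chern roots of $\mathscr{E}$, and let $k_i\ge 0$ be the integer such that the multiplicity of $L_i$ as a Chern root is $k_i+1$, so that $c(\mathscr{E})=\prod_{i=1}^m(1+L_i)^{k_i+1}$. Let $\alpha\in A_*\mathbb{P}(\mathscr{E})$ be written as $$\alpha=\alpha_0+\alpha_1H+\alpha_2H^2+\cdots$$ (a finite sum, with coefficients $\alpha_j\in A_*X$), and for a variable $x$ write $\alpha(x)=\alpha_0+\alpha_1x+\alpha_2x^2+\cdots$. Then the proper pushforward $\pi_*:A_*\mathbb{P}(\mathscr{E})\to A_*X$ satisfies $$\pi_*\alpha=\left.\left(D\cdot\sum_{i=1}^m g_\alpha(x_i)\right)\right|_{x_1=-L_1,\ldots,x_m=-L_m}\in A_*X,$$ where $$g_\alpha(x_i)=\frac{\alpha(x_i)-\left(\alpha_0+\alpha_1x_i+\cdots+\alpha_{r-2}x_i^{r-2}\right)}{x_i^{\,r-m}\prod_{l=1,\,l\neq i}^m(x_i-x_l)}$$ and $D$ is the linear operator on $A_*X[x_1,\ldots,x_m]$ given by $$g\mapsto\frac{1}{k_1!\cdots k_m!}\,\frac{\partial^{k_1+\cdots+k_m}}{\partial x_1^{k_1}\cdots\partial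 x_m^{k_m}}\left(x_1^{k_1}\cdots x_m^{k_m}\cdot g\right).$$
   Context: $A_*$ denotes the Chow group of algebraic cycles modulo rational equivalence; since $X$ is smooth, $A_*X$ and $A_*\mathbb{P}(\mathscr{E})$ are rings under intersection product. $\mathbb{P}(\mathscr{E})$ is the projective bundle of lines (not hyperplanes) in the fibers of $\mathscr{E}$; $\mathscr{O}(-1)$ is the tautological line subbundle of $\pi^*\mathscr{E}$, $\mathscr{O}(1)$ is its dual, and $H$ is its first Chern class. Elements of $A_*X$ are regarded as elements of $A_*\mathbb{P}(\mathscr{E})$ via $\pi^*$, and $A_*\mathbb{P}(\mathscr{E})\cong A_*X[H]/(H^r+c_1(\mathscr{E})H^{r-1}+\cdots+c_r(\mathscr{E}))$, so every class is a polynomial in $H$ with coefficients in $A_*X$ (such an expression need not be unique; any one may be used). The Chern roots of $\mathscr{E}$ are the formal roots of its Chern class (splitting principle): elements $\lambda_1,\ldots,\lambda_r$ of an extension ring of $A_*X$ with $c(\mathscr{E})=(1+\lambda_1)\cdots(1+\lambda_r)$. The sum $\sum_i g_\alpha(x_i)$ is, after putting it over a common denominator and cancelling, a polynomial in $A_*X[x_1,\ldots,x_m]$; $D$ is applied to this polynomial and the result (whose coefficients are integral multiples of elements of $A_*X$) is then evaluated at $x_i=-L_i$. Empty sums are $0$ and empty products are $1$. *)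

(* Defs.v *)
From HB Require Import structures.
From mathcomp Require Import all_boot all_order all_algebra.
From mathcomp.multinomials Require Import mpoly.

Set Implicit Arguments.
Unset Strict Implicit.
Unset Printing Implicit Defensive.

Import GRing.Theory.
Local Open Scope ring_scope.

(* No library provides schemes or Chow groups, so the Chow theory of smooth
   compact varieties over C enters through its standard calculus (Fulton,
   "Intersection Theory", Chapters 3 and 8).  The intended model is:
   - [variety]: smooth compact (irreducible) complex varieties, [mor]: their
     morphisms (all of them proper), [bundle X]: algebraic vector bundles on X;
   - [chow X]: the ring A_*X of cycles modulo rational equivalence under the
     intersection product, [codim p]: its graded piece of classes of cycles of
     codimension p, i.e. of dimension [dim X - p];
   - [exact E' E E'']: there is an exact sequence 0 -> E' -> E -> E'' -> 0;
   - [projb], [taut]: the bundle P(E) of lines in the fibers of E, and the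
     tautological line subbundle O(-1) of pi^*E.
   P(E) is only formed in positive rank, where it is a nonempty variety. *)
Record chow_theory := ChowTheory {
  variety : Type;
  dim : variety -> nat;
  mor : variety -> variety -> Type;
  idm : forall X, mor X X;
  compm : forall X Y Z, mor Y Z -> mor X Y -> mor X Z;

  chow : variety -> comNzRingType;
  codim : forall X, nat -> chow X -> Prop;
  codim0 : forall X p, @codim X p 0;
  codimB : forall X p (x y : chow X), codim p x -> codim p y -> codim p (x - y);
  codim1 : forall X, @codim X 0 1;
  codimM : forall X p q (x y : chow X),
    codim p x -> codim q y -> codim (p + q) (x * y);
  codim_large : forall X p (x : chow X), (dim X < p)%N -> codim p x -> x = 0;
  codim_decomp : forall X (x : chow X), exists! c : {ffun 'I_(dim X).+1 -> chow X},
    (forall p : 'I_(dim X).+1, codim p (c p)) /\ x = \sum_p c p;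

  pull : forall X Y, mor X Y -> {rmorphism chow Y -> chow X};
  pull_id : forall X (x : chow X), pull (idm X) x = x;
  pull_comp : forall X Y Z (g : mor Y Z) (f : mor X Y) (z : chow Z),
    pull (compm g f) z = pull f (pull g z);
  pull_codim : forall X Y (f : mor X Y) p (y : chow Y),
    codim p y -> codim p (pull f y);

  push : forall X Y, mor X Y -> {additive chow X -> chow Y};
  push_id : forall X (x : chow X), push (idm X) x = x;
  push_comp : forall X Y Z (g : mor Y Z) (f : mor X Y) (x : chow X),
    push (compm g f) x = push g (push f x);
  (* f_* preserves the dimension of cycles, hence shifts codimensions by
     dim Y - dim X and kills the cycles of dimension larger than dim Y. *)
  push_codim : forall X Y (f : mor X Y) p q (x : chow X),
    (p + dim Y = q + dim X)%N -> codim p x -> codim q (push f x);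
  push_codim_small : forall X Y (f : mor X Y) p (x : chow X),
    (p + dim Y < dim X)%N -> codim p x -> push f x = 0;
  projection_formula : forall X Y (f : mor X Y) (y : chow Y) (x : chow X),
    push f (pull f y * x) = y * push f x;

  bundle : variety -> Type;
  rank : forall X, bundle X -> nat;
  pullb : forall X Y, mor X Y -> bundle Y -> bundle X;
  rank_pullb : forall X Y (f : mor X Y) (E : bundle Y), rank (pullb f E) = rank E;
  dualb : forall X, bundle X -> bundle X;
  rank_dualb : forall X (E : bundle X), rank (dualb E) = rank E;
  exact : forall X, bundle X -> bundle X -> bundle X -> Prop;
  rank_exact : forall X (E' E E'' : bundle X),
    exact E' E E'' -> rank E = (rank E' + rank E'')%N;

  chern : forall X, bundle X -> nat -> chow X;
  chern_codim : forall X (E : bundle X) i, codim i (chern E i);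
  chern0 : forall X (E : bundle X), chern E 0 = 1;
  chern_large : forall X (E : bundle X) i, (rank E < i)%N -> chern E i = 0;
  chern_pullb : forall X Y (f : mor X Y) (E : bundle Y) i,
    chern (pullb f E) i = pull f (chern E i);
  chern_dualb : forall X (E : bundle X) i,
    chern (dualb E) i = (-1) ^+ i * chern E i;
  whitney : forall X (E' E E'' : bundle X) n, exact E' E E'' ->
    chern E n = \sum_(i < n.+1) chern E' i * chern E'' (n - i);

  projb : forall X (E : bundle X), (0 < rank E)%N -> variety;
  dim_projb : forall X (E : bundle X) (rE : (0 < rank E)%N),
    dim (projb rE) = (dim X + (rank E).-1)%N;
  projm : forall X (E : bundle X) (rE : (0 < rank E)%N), mor (projb rE) X;
  taut : forall X (E : bundle X) (rE : (0 < rank E)%N), bundle (projb rE);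
  rank_taut : forall X (E : bundle X) (rE : (0 < rank E)%N), rank (taut rE) = 1%N;
  taut_sub : forall X (E : bundle X) (rE : (0 < rank E)%N),
    exists Q, exact (taut rE) (pullb (projm rE) E) Q;
  (* A_*P(E) is free over A_*X on the powers H^j, j < rank E, H = c_1(O(1)). *)
  projb_basis : forall X (E : bundle X) (rE : (0 < rank E)%N) (b : chow (projb rE)),
    exists! a : {ffun 'I_(rank E) -> chow X},
      b = \sum_j pull (projm rE) (a j) * chern (dualb (taut rE)) 1 ^+ j;
  (* H restricts to the hyperplane class of each fiber, a projective space. *)
  push_top : forall X (E : bundle X) (rE : (0 < rank E)%N),
    push (projm rE) (chern (dualb (taut rE)) 1 ^+ (rank E).-1) = 1
}.

Arguments projb {c X E} rE.
Arguments projm {c X E} rE.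
Arguments taut {c X E} rE.

Section Chow.
Variable T : chow_theory.

Definition hclass (X : variety T) (E : bundle X) (rE : (0 < rank E)%N) :
  chow (projb rE) := chern (dualb (taut rE)) 1.

Definition chern_poly (X : variety T) (E : bundle X) : {poly chow X} :=
  \poly_(i < (rank E).+1) chern E i.

(* The factorization c(E) = (1 + l_1) ... (1 + l_r) of the total Chern class is
   understood degree by degree (each root has degree 1): c_i(E) is the i-th
   elementary symmetric function of the roots. *)
Definition chern_roots (X : variety T) (E : bundle X) (B : comNzRingType)
    (iota : {rmorphism chow X -> B}) (lambda : (rank E).-tuple B) : Prop :=
  map_poly iota (chern_poly E) = \prod_(l <- lambda) (1 + l *: 'X).
End Chow.

(* S is the value of the sum of fractions \sum_i num i / den i.  It is meant for
   non-zero-divisors den i, where S is unique if it exists. *)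
Definition is_sum_of_fractions (R : comNzRingType) (m : nat)
    (num den : 'I_m -> R) (S : R) : Prop :=
  (\prod_i den i) * S = \sum_i num i * \prod_(j | j != i) den j.

Section Formula.
Variables (A : comNzRingType) (m : nat).
Implicit Types (a : {poly A}) (p : {mpoly A[m]}) (k : 'X_{1..m}).

(* g_num a r i / g_den r i is g_alpha(x_i), for alpha(x) = a. *)
Definition g_num a (r : nat) (i : 'I_m) : {mpoly A[m]} :=
  (map_poly (mpolyC m (R := A)) a).['X_i] - \sum_(j < r.-1) (a`_j)%:MP * 'X_i ^+ j.

(* The subtraction r - m is in nat; m <= r when m counts distinct roots. *)
Definition g_den (r : nat) (i : 'I_m) : {mpoly A[m]} :=
  'X_i ^+ (r - m) * \prod_(l | l != i) ('X_i - 'X_l).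

(* 1/(k_1! ... k_m!) times the mixed partial derivative of order k.  On the
   monomial x^n it is \prod_i 'C(n_i, k_i) x^(n - k), which makes sense over any
   ring of coefficients, in particular if A has torsion. *)
Definition mdivderiv k p : {mpoly A[m]} :=
  \sum_(n <- msupp p) (p@_n *+ \prod_i 'C(n i, k i)) *: 'X_[n - k].

Lemma mdivderivE k p : mdivderiv k p *+ (\prod_i (k i)`!) = p^`M[k].
Proof.
rewrite [in RHS](mpolyE p) raddf_sum /mdivderiv -sumrMnl.
apply: eq_bigr => n _ /=; rewrite mderivmZ mderivmX scalerMnl -mulrnA -big_split /=.
under eq_bigr do rewrite bin_ffact.
by rewrite scaler_nat -scalerMnr -scalerMnl.
Qed.

Definition Dop k p : {mpoly A[m]} := mdivderiv k ('X_[k] * p).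
End Formula.

(* Main.v *)
(* Put [y_n = pi_* H^n].  It vanishes for [n < r - 1] since [pi] lowers the
   codimension by [r - 1], and [y_(r-1) = 1].  The Whitney formula for
   [0 -> O(-1) -> pi^*E -> Q -> 0] gives [H^r + c_1 H^(r-1) + ... + c_r = 0],
   i.e. a linear recurrence for [y], whence
     [\sum_d y_(d+r-1) t^d = 1 / c_t(E) = \prod_i (1 + L_i t)^-(k_i + 1)].
   The sums [\sum_i x_i^(d+m-1) / \prod_(l != i) (x_i - x_l)] obey a recurrence
   of the same kind, with initial values given by Lagrange interpolation, so
   they are the complete homogeneous polynomials [h_d(x)], of generating
   function [\prod_i 1 / (1 - x_i t)].  As [D] multiplies [x^n] by
   [\prod_i 'C(n_i + k_i, k_i)], it turns this function into
   [\prod_i (1 - x_i t)^-(k_i + 1)], and [x_i = - L_i] gives [1 / c_t(E)]. *)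
Require Import Defs.
From mathcomp Require Import all_boot all_order all_algebra.
From mathcomp.multinomials Require Import mpoly.
From mathcomp.multinomials Require ssrcomplements.
From mathcomp Require Import zify.

Set Implicit Arguments.
Unset Strict Implicit.
Unset Printing Implicit Defensive.
Import GRing.Theory.
Local Open Scope ring_scope.

(** * Formal power series, as coefficient sequences, and linear recurrences *)

Section Recurrence.
Variable R : comNzRingType.
Implicit Types (c s t u y : nat -> R).

Definition inverse_series c u :=
  forall d, \sum_(i < d.+1) c i * u (d - i)%N = (d == 0)%:R.

Lemma convolution_inj c s t : c 0 = 1 ->
  (forall d, \sum_(i < d.+1) c i * s (d - i)%N = \sum_(i < d.+1) c i * t (d - i)%N) ->
  s =1 t.
Proof.
move=> c0 eq_st; elim/ltn_ind => d IHd.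
have := eq_st d; rewrite !big_ord_recl c0 !mul1r subn0.
rewrite [X in _ = _ + X -> _](eq_bigr (fun i : 'I_d =>
  c (bump 0 i) * s (d - bump 0 i)%N)) => [/addIr//|i _].
by rewrite IHd // ltn_subrL; case: (d) i => [[]|].
Qed.

(** The series of [c] times that of the shifted sequence [y (d + r.-1)] is the constant [b]: the
    recurrence kills every coefficient of positive degree. Dividing by [c] gives [b * u]. *)
Lemma recurrence_solution r c y u b : (0 < r)%N -> c 0 = 1 ->
    (forall i, (r < i)%N -> c i = 0) ->
    (forall n, (n < r.-1)%N -> y n = 0) -> y r.-1 = b ->
    (forall n, \sum_(i < r.+1) c i * y (n + (r - i))%N = 0) ->
    inverse_series c u ->
  forall d, y (d + r.-1)%N = b * u d.
Proof.
case: r => //= r _ c0 c_gt y_lt yr rec cu.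
apply: (@convolution_inj c (fun d => y (d + r)%N) (fun d => b * u d)) => // d.
under [RHS]eq_bigr do rewrite mulrCA.
rewrite -mulr_sumr cu; case: d => [|d].
  by rewrite big_ord1 c0 mul1r mulr1 yr.
rewrite mulr0; apply: etrans (rec d).
pose F i := c i * y (d + r.+1 - i)%N.
(* The convolution stops at [i = d.+1], the recurrence at [i = r.+1]. Past the first bound [y]
   vanishes, past the second [c] does, so both sums equal their common initial part. The bound on
   [i] keeps the subtraction in [F] exact. *)
have F0 i : (minn d.+2 r.+2 <= i)%N -> (i <= d + r.+1)%N -> F i = 0.
  rewrite geq_min /F => /orP[lt_di | /c_gt->]; last by rewrite mul0r.
  move=> le_i; rewrite y_lt ?mulr0 // ltn_subLR //.
  by rewrite -addSnnS ltn_add2r.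
have trunc n : (minn d.+2 r.+2 <= n)%N -> (n <= (d + r.+1).+1)%N ->
    \sum_(i < n) F i = \sum_(i < minn d.+2 r.+2) F i.
  move=> le_n n_le; rewrite -!(big_mkord xpredT) (big_cat_nat _ le_n) //=.
  rewrite [X in _ + X]big_nat_cond [X in _ + X]big1 ?addr0 // => i.
  by case/andP=> /andP[le_i lt_i] _; apply: F0 => //; rewrite -ltnS (leq_trans lt_i).
transitivity (\sum_(i < d.+2) F i).
  by apply: eq_bigr => i _; rewrite /F -addSnnS addnBAC // -ltnS.
rewrite trunc ?geq_minl ?ltnS ?leq_add2l //; last by rewrite -addSnnS leq_addr.
rewrite -(trunc r.+2) ?geq_minr ?ltnS ?leq_addl //.
by apply: eq_bigr => i _; rewrite /F addnBA // -ltnS.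
Qed.
End Recurrence.

(** * Products of finitely many power series *)

Section CauchyProduct.
Variables (R : comNzRingType) (m : nat).
Implicit Types (w : 'I_m -> nat -> R).

(** The coefficient of [t^d] in the product of the series with coefficients [w i]; bounding
    exponents by [d] makes the index set finite. *)
Definition cauchy_prod w d : R :=
  \sum_(f : {ffun 'I_m -> 'I_d.+1} | (\sum_i f i)%N == d) \prod_i w i (f i).

Lemma coef_prod_trunc (F G : 'I_m -> {poly R}) d :
    (forall i j, (j <= d)%N -> (F i)`_j = (G i)`_j) ->
  forall j, (j <= d)%N -> (\prod_i F i)`_j = (\prod_i G i)`_j.
Proof.
move=> eqFG; elim/big_rec2: _ => // i p q _ IHpq j le_jd.
rewrite !coefM; apply: eq_bigr => l _; congr (_ * _).
  by apply: eqFG; rewrite (leq_trans _ le_jd) // -ltnS.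
by apply: IHpq; rewrite (leq_trans _ le_jd) ?leq_subr.
Qed.

Lemma coef_cauchy_prod w n d : (d <= n)%N ->
  (\prod_i \poly_(j < n.+1) w i j)`_d = cauchy_prod w d.
Proof.
move=> le_dn; rewrite (@coef_prod_trunc _ (fun i => \poly_(j < d.+1) w i j) d) //.
  under eq_bigr do rewrite poly_def.
  rewrite bigA_distr_bigA coef_sum /cauchy_prod [RHS]big_mkcond.
  apply: eq_bigr => f _.
  by rewrite scaler_prod prodrXr coefZ coefXn eq_sym; case: ifP; rewrite ?mulr1 ?mulr0.
by move=> i j le_jd; rewrite !coef_poly !ltnS le_jd (leq_trans le_jd).
Qed.

(** In degrees up to [d] each series may be truncated to a polynomial; paired with its [p i], it
    gives a factor that agrees with 1 up to degree [d]. *)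
Lemma inverse_cauchy_prod (p : 'I_m -> {poly R}) w :
    (forall i, inverse_series (nth 0 (p i)) (w i)) ->
  inverse_series (nth 0 (\prod_i p i)) (cauchy_prod w).
Proof.
move=> pw d; transitivity ((\prod_i (p i * \poly_(j < d.+1) w i j))`_d).
  rewrite big_split coefM; apply: eq_bigr => i _.
  by rewrite coef_cauchy_prod ?leq_subr.
rewrite (@coef_prod_trunc _ (fun=> 1) d) ?big1_eq ?coef1 // => i j le_jd.
rewrite coefM coef1 -(pw i); apply: eq_bigr => l _.
by rewrite coef_poly ltnS (leq_trans _ le_jd) ?leq_subr.
Qed.
End CauchyProduct.

Lemma rmorph_cauchy_prod (R S : comNzRingType) (phi : {rmorphism R -> S}) m
    (w : 'I_m -> nat -> R) d :
  phi (cauchy_prod w d) = cauchy_prod (fun i n => phi (w i n)) d.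
Proof. by rewrite rmorph_sum; apply: eq_bigr => f _; rewrite rmorph_prod. Qed.

Lemma eq_cauchy_prod (R : comNzRingType) m (w w' : 'I_m -> nat -> R) d :
  (forall i, w i =1 w' i) -> cauchy_prod w d = cauchy_prod w' d.
Proof. by move=> eq_w; apply: eq_bigr => f _; apply: eq_bigr => i _; apply: eq_w. Qed.

(** * Inverses of powers and products of linear polynomials *)

Lemma inverse_seriesM (R : comNzRingType) (p q : {poly R}) u v :
    inverse_series (nth 0 p) u ->
    (forall d, \sum_(i < d.+1) q`_i * v (d - i)%N = u d) ->
  inverse_series (nth 0 (p * q)) v.
Proof.
move=> pu qv d; transitivity ((p * q * \poly_(j < d.+1) v j)`_d).
  by rewrite coefM; apply: eq_bigr => i _; rewrite coef_poly ltnS leq_subr.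
rewrite -mulrA coefM -pu; apply: eq_bigr => i _.
rewrite coefM -qv; congr (_ * _); apply: eq_bigr => j _.
by rewrite coef_poly ltnS -subnDA leq_subr.
Qed.

(** Multiplying the series for [k.+1] by [1 + l t] gives the series for [k], by Pascal's rule. *)
Lemma inverse_negbinomial (R : comNzRingType) (l : R) k :
  inverse_series (nth 0 ((1 + l *: 'X) ^+ k.+1)) (fun n => (- l) ^+ n *+ 'C(n + k, k)).
Proof.
have lin (v : nat -> R) n :
    \sum_(i < n.+2) (1 + l *: 'X : {poly R})`_i * v (n.+1 - i)%N = v n.+1 + l * v n.
  rewrite big_ord_recl big_ord_recl big1 ?addr0 /= => [|i _].
    by rewrite !coefE !(mulr0, mulr1, addr0, add0r) mul1r subn0 subSS subn0.
  by rewrite !coefE /= mulr0 addr0 mul0r.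
have lin0 (v : nat -> R) : \sum_(i < 1) (1 + l *: 'X : {poly R})`_i * v (0 - i)%N = v 0.
  by rewrite big_ord1 !coefE /= mulr0 addr0 mul1r.
elim: k => [|k IHk]; rewrite exprSr.
  apply: (@inverse_seriesM _ _ _ (fun d => (d == 0)%:R)) => [d|[|d]].
  - rewrite expr0 big_ord_recl big1 ?addr0 /= => [|i _]; last by rewrite coef1 mul0r.
    by rewrite coef1 mul1r subn0.
  - by rewrite (lin0 (fun n => (- l) ^+ n *+ 'C(n + 0, 0))) bin0.
  - rewrite (lin (fun n => (- l) ^+ n *+ 'C(n + 0, 0))) !bin0 !mulr1n.
    by rewrite exprS mulNr addNr.
pose v n := (- l) ^+ n *+ 'C(n + k.+1, k.+1).
apply: (@inverse_seriesM _ _ _ _ v IHk) => -[|d]; first by rewrite lin0 /v !add0n !binn.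
by rewrite lin /v addnS binS mulrnDr exprS mulNr mulrnAr addrAC !mulNrn -addSnnS addNr add0r.
Qed.

Lemma prod_linear_size (R : comNzRingType) (s : seq R) :
  (size (\prod_(a <- s) (1 + a *: 'X : {poly R}))%R <= (size s).+1)%N.
Proof.
elim: s => [|a s IHs]; first by rewrite big_nil size_poly1.
rewrite big_cons mulrDl mul1r -scalerAl mulrC.
apply: leq_trans (size_polyD _ _) _; rewrite geq_max (leqW IHs) /=.
apply: leq_trans (size_scale_leq _ _) _.
by rewrite (leq_trans (size_polyMleq _ _)) // size_polyX addn2.
Qed.

(** Homogenizing in degree [size s] turns each factor [1 + a t] into [x + a]. Hence the powers of
    [x] satisfy the recurrence given by the product as soon as [- x] occurs in [s]. *)
Lemma prod_linear_homog (R : comNzRingType) (s : seq R) x :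
  \sum_(i < (size s).+1) (\prod_(a <- s) (1 + a *: 'X : {poly R}))`_i * x ^+ (size s - i)
    = \prod_(a <- s) (x + a).
Proof.
elim: s => [|a s IHs]; first by rewrite big_ord1 !big_nil coef1 mulr1.
rewrite /= !big_cons -{}IHs; set p := \prod_(_ <- _) _.
have coefE i : ((1 + a *: 'X) * p)`_i = p`_i + a * (if i == 0 then 0 else p`_i.-1).
  by rewrite mulrDl mul1r -scalerAl coefD coefZ coefXM.
under eq_bigr do rewrite coefE mulrDl; rewrite big_split /= mulrDl; congr (_ + _).
  rewrite big_ord_recr /= subnn nth_default ?prod_linear_size // mul0r addr0 mulr_sumr.
  by apply: eq_bigr => i _; rewrite subSn -1?ltnS // exprS mulrCA.
rewrite big_ord_recl /= mulr0 mul0r add0r mulr_sumr.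
by apply: eq_bigr => i _; rewrite mulrA.
Qed.

(** * Lagrange sums and complete homogeneous polynomials *)

Definition complete_homog (R : comNzRingType) m (x : 'I_m -> R) d :=
  cauchy_prod (fun i n => x i ^+ n) d.

Definition lagrange_den (R : comNzRingType) m (x : 'I_m -> R) i :=
  \prod_(l | l != i) (x i - x l).

(* The numerator of [\sum_i x_i ^ n / lagrange_den x i] over the common
   denominator [\prod_i lagrange_den x i]. *)
Definition lagrange_sum (R : comNzRingType) m (x : 'I_m -> R) n :=
  \sum_i x i ^+ n * \prod_(j | j != i) lagrange_den x j.

(** Interpolation at [m] distinct points reproduces ['X^n] for [n < m]; the identity compares
    coefficients of degree [m.-1]. *)
Lemma lagrange_sum_small (R : idomainType) m (x : 'I_m -> R) n : injective x ->
  (n < m)%N ->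
  lagrange_sum x n = (n == m.-1)%:R * \prod_i lagrange_den x i.
Proof.
move=> x_inj lt_nm; have m_gt0 : (0 < m)%N by case: (m) lt_nm.
pose q i : {poly R} := \prod_(l | l != i) ('X - (x l)%:P).
have q_enum i : q i = \prod_(l <- enum (predC1 i)) ('X - (x l)%:P) by rewrite big_enum.
have size_q i : size (q i) = m.
  by rewrite q_enum size_prod_XsubC -cardE cardC1 card_ord prednK.
have q_root i j : j != i -> (q i).[x j] = 0.
  by move=> ne_ji; rewrite horner_prod (bigD1 j) //= hornerXsubC subrr mul0r.
have q_den i : (q i).[x i] = lagrange_den x i.
  by rewrite horner_prod; apply: eq_bigr => l _; rewrite hornerXsubC.
pose c i := x i ^+ n * \prod_(j | j != i) lagrange_den x j.
(* Lagrange interpolation of ['X^n], with denominators cleared. *)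
have interp : \sum_i c i *: q i = (\prod_i lagrange_den x i) *: 'X^n.
  apply/eqP; rewrite -subr_eq0; apply/eqP.
  apply: (@roots_geq_poly_eq0 _ _ [seq x i | i <- enum 'I_m]).
  - apply/allP=> _ /mapP[j _ ->]; rewrite rootE hornerD hornerN hornerZ hornerXn horner_sum.
    rewrite (bigD1 j) //= big1 => [|i ne_ij].
      rewrite hornerZ q_den /c [in X in _ - X](bigD1 j) //= addr0.
      by rewrite -mulrA mulrC [_ * lagrange_den x j]mulrC subrr.
    by rewrite hornerZ q_root ?mulr0 // eq_sym.
  - by rewrite map_inj_uniq ?enum_uniq.
  rewrite size_map size_enum_ord; apply: leq_trans (size_polyD _ _) _.
  rewrite geq_max size_polyN (leq_trans (size_scale_leq _ _)) ?size_polyXn // andbT.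
  apply: leq_trans (size_sum _ _ _) _; apply/bigmax_leqP => i _.
  by rewrite (leq_trans (size_scale_leq _ _)) ?size_q.
have := congr1 (coefp m.-1) interp.
rewrite /= coef_sum coefZ coefXn mulrC eq_sym => <-.
apply: eq_bigr => i _; rewrite coefZ -[in (q i)`_ _](size_q i) -lead_coefE.
by rewrite (monicP _) ?mulr1 // q_enum monic_prod_XsubC.
Qed.

Lemma lagrange_sumE_idomain (R : idomainType) m (x : 'I_m -> R) d : injective x ->
  (0 < m)%N ->
  lagrange_sum x (d + m.-1) = (\prod_i lagrange_den x i) * complete_homog x d.
Proof.
move=> x_inj m_gt0; pose s := [seq - x i | i <- enum 'I_m].
have size_s : size s = m by rewrite size_map size_enum_ord.
pose p := \prod_(a <- s) (1 + a *: 'X : {poly R}).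
(* The exponent 1 makes each factor an instance of [inverse_negbinomial] with [k = 0], whose inverse
   is a geometric series. *)
have pE : p = \prod_i (1 + (- x i) *: 'X) ^+ 1 by rewrite /p big_map big_enum.
apply: (@recurrence_solution _ m (nth 0 p) (lagrange_sum x)) => //.
- rewrite -horner_coef0 horner_prod big1 // => a _.
  by rewrite !hornerE.
- move=> i lt_mi; rewrite nth_default // (leq_trans _ lt_mi) //.
  by have := prod_linear_size s; rewrite size_s.
- move=> n lt_n; rewrite lagrange_sum_small //; last by rewrite (leq_trans lt_n) ?leq_pred.
  by rewrite ltn_eqF ?mul0r.
- by rewrite lagrange_sum_small ?eqxx ?mul1r // prednK.
- move=> n; under eq_bigr do rewrite mulr_sumr.
  rewrite exchange_big big1 //= => j _.
  (* Each node contributes 0 separately: the homogenized [p] vanishes at [x j] because [- x j] is in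
     [s]. *)
  transitivity (x j ^+ n * (\prod_(i | i != j) lagrange_den x i) *
    \prod_(a <- s) (x j + a)).
    rewrite -prod_linear_homog size_s mulr_sumr; apply: eq_bigr => i _.
    by rewrite exprD -!mulrA mulrCA; congr (_ * _); rewrite mulrA mulrC.
  by rewrite big_map big_enum (bigD1 j) //= subrr mul0r mulr0.
rewrite pE; apply: inverse_cauchy_prod => i e; rewrite -(inverse_negbinomial (- x i) 0).
by apply: eq_bigr => l _; rewrite opprK bin0.
Qed.

Lemma rmorph_lagrange_den (R S : comNzRingType) (phi : {rmorphism R -> S}) m
    (x : 'I_m -> R) i :
  phi (lagrange_den x i) = lagrange_den (phi \o x) i.
Proof. by rewrite rmorph_prod; apply: eq_bigr => l _; rewrite rmorphB. Qed.

(* Over a ring with zero divisors interpolation is not available, so the identity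
   is proved for integral polynomials and mapped to [A]. *)
Lemma lagrange_sumE (A : comNzRingType) m d : (0 < m)%N ->
  lagrange_sum (fun i : 'I_m => 'X_i : {mpoly A[m]}) (d + m.-1) =
  (\prod_i lagrange_den (fun i : 'I_m => 'X_i) i) * complete_homog (fun i => 'X_i) d.
Proof.
move=> m_gt0; pose phi : {rmorphism {mpoly int[m]} -> {mpoly A[m]}} :=
  map_mpoly (intmul 1 : int -> A).
have phiX i : phi 'X_i = 'X_i by rewrite /phi /= map_mpolyX.
have X_inj : injective (fun i : 'I_m => 'X_i : {mpoly int[m]}).
  move=> i j /(congr1 (mcoeff U_(i))) /eqP; rewrite !mcoeffXU eqxx.
  by case: (j =P i).
have phi_den i : phi (lagrange_den (fun i : 'I_m => 'X_i) i) =
    lagrange_den (fun i => 'X_i) i.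
  by rewrite rmorph_lagrange_den; apply: eq_bigr => l _; rewrite /comp !phiX.
have := congr1 phi (lagrange_sumE_idomain d X_inj m_gt0).
rewrite rmorphM rmorph_prod rmorph_cauchy_prod (eq_bigr _ (fun i _ => phi_den i)).
move=> eq_phi; apply: etrans (etrans eq_phi _).
  rewrite rmorph_sum; apply: eq_bigr => i _.
  rewrite rmorphM rmorphXn rmorph_prod phiX; congr (_ * _).
  by apply: eq_bigr => j _; rewrite phi_den.
by congr (_ * _); apply: eq_cauchy_prod => i n; rewrite rmorphXn phiX.
Qed.

(** * The operator [D], and regularity of the denominators *)

Section Multivariate.
Variables (A : comNzRingType) (m : nat).
Implicit Types (k n : 'X_{1..m}) (p : {mpoly A[m]}).

(** Truncation in [n' - k] could let other monomials land on [n], but unless [k <= n'] some binomial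
    coefficient is zero. *)
Lemma mcoeff_mdivderiv k p n :
  (mdivderiv k p)@_n = p@_(n + k) *+ \prod_i 'C((n + k)%MM i, k i).
Proof.
have coefE n' : ((p@_n' *+ \prod_i 'C(n' i, k i)) *: 'X_[n' - k] : {mpoly A[m]})@_n =
    if n' == (n + k)%MM then p@_(n + k) *+ \prod_i 'C((n + k)%MM i, k i) else 0.
  rewrite mcoeffZ mcoeffX; have [->|ne_n'] := eqVneq n' (n + k)%MM.
    by rewrite addmK eqxx mulr1.
  have [/forallP le_k|] := boolP [forall i, k i <= n' i]%N.
    rewrite (_ : (n' - k)%MM == n = false) ?mulr0 //.
    by apply: contraNF ne_n' => /eqP <-; rewrite submK //; apply/mnm_lepP.
  case/forallPn=> i; rewrite -ltnNge => lt_i.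
  by rewrite (bigD1 i) //= bin_small // mul0n mulr0n mul0r.
rewrite /mdivderiv raddf_sum /= (eq_bigr _ (fun n' _ => coefE n')).
have [n_in|n_out] := boolP ((n + k)%MM \in msupp p).
  by rewrite (bigD1_seq _ n_in (msupp_uniq p)) /= eqxx [X in _ + X]big1 ?addr0 // => n' /negbTE->.
rewrite (memN_msupp_eq0 n_out) mul0rn big1_seq // => n' /andP[_ n'_in].
by case: eqP => // eq_n'; rewrite -eq_n' n'_in in n_out.
Qed.

Lemma mcoeff_Dop k p n : (Dop k p)@_n = p@_n *+ \prod_i 'C(n i + k i, k i).
Proof.
rewrite /Dop mcoeff_mdivderiv ['X_[k] * p]mulrC [in X in X *+ _]addmC mcoeffMX; congr (_ *+ _).
by apply: eq_bigr => i _; rewrite mnmDE.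
Qed.

Lemma DopX k n :
  Dop k 'X_[n] = 'X_[n] *+ \prod_i 'C(n i + k i, k i) :> {mpoly A[m]}.
Proof.
apply/mpolyP=> n'; rewrite mcoeff_Dop mcoeffMn mcoeffX.
by case: eqP => [->|_]; rewrite ?mul0rn.
Qed.

Lemma Dop_sum k (I : Type) (r : seq I) (P : pred I) (F : I -> {mpoly A[m]}) :
  Dop k (\sum_(i <- r | P i) F i) = \sum_(i <- r | P i) Dop k (F i).
Proof.
apply/mpolyP=> n; rewrite mcoeff_Dop !raddf_sum -sumrMnl.
by apply: eq_bigr => i _; rewrite [RHS]mcoeff_Dop.
Qed.

Lemma DopCM k (c : A) p : Dop k (c%:MP * p) = c%:MP * Dop k p.
Proof. by apply/mpolyP=> n; rewrite mcoeffCM !mcoeff_Dop mcoeffCM mulrnAr. Qed.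

(** The factor by which [D] scales a monomial splits over the variables, so the result is again a
    Cauchy product. *)
Lemma Dop_complete_homog k d :
  Dop k (complete_homog (fun i => 'X_i) d) =
  cauchy_prod (fun i e => 'X_i ^+ e *+ 'C(e + k i, k i)) d :> {mpoly A[m]}.
Proof.
rewrite Dop_sum; apply: eq_bigr => f _.
have -> : \prod_i 'X_i ^+ f i = 'X_[[multinom (f i : nat) | i < m]] :> {mpoly A[m]}.
  by rewrite [RHS]mpolyXE_id; apply: eq_bigr => i _; rewrite mnmE.
rewrite DopX prodrMn mpolyXE_id; congr (_ *+ _);
  by apply: eq_bigr => i _; rewrite mnmE.
Qed.

Lemma lreg_mpolyX n : GRing.lreg ('X_[n] : {mpoly A[m]}).
Proof. by apply: lreg_mleadc; rewrite mleadXm mcoeffX eqxx; apply: lreg1. Qed.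

(** The leading coefficient is 1 or -1, according to which variable is larger, hence regular over
    any ring. *)
Lemma lreg_subX (i l : 'I_m) : l != i -> GRing.lreg ('X_i - 'X_l : {mpoly A[m]}).
Proof.
move=> ne_li; apply: lreg_mleadc.
have [lt_il|lt_li|/mnmP/(_ i)] :=
    Order.TotalTheory.ltgtP (U_(i)%MM : 'X_{1..m}) U_(l)%MM; last first.
- by rewrite !mnm1E eqxx (negbTE ne_li).
- rewrite mleadDl ?mleadN ?mleadXm // mcoeffB !mcoeffXU eqxx (negbTE ne_li) subr0.
  exact: lreg1.
rewrite mleadDr ?mleadN ?mleadXm // mcoeffB !mcoeffXU eqxx eq_sym (negbTE ne_li) sub0r.
exact/lregN/lreg1.
Qed.

Lemma lreg_prod_g_den r : GRing.lreg (\prod_i g_den A r i : {mpoly A[m]}).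
Proof.
apply: ssrcomplements.lreg_prod => i _ _; apply: lregM; first exact/lregX/lreg_mpolyX.
by apply: ssrcomplements.lreg_prod => l _; apply: lreg_subX.
Qed.
End Multivariate.

(** * The sum of the fractions [g_alpha(x_i)] as a polynomial *)

Lemma horner_map_pad (R S : comNzRingType) (f : {rmorphism R -> S}) (a : {poly R}) n x :
  (map_poly f a).[x] =
  \sum_(i < n) f a`_i * x ^+ i + \sum_(i < size a) f a`_(n + i) * x ^+ (n + i).
Proof.
rewrite (@horner_coef_wide _ (n + size a)).
  by rewrite big_split_ord; congr (_ + _); apply: eq_bigr => i _; rewrite coef_map.
by rewrite (leq_trans (size_poly _ _)) ?leq_addl.
Qed.

Section Fractions.
Variables (A : comNzRingType) (m r : nat) (a : {poly A}).

Lemma g_numE (i : 'I_m) :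
  g_num a r i = \sum_(d < size a) (a`_(r.-1 + d))%:MP * 'X_i ^+ (r.-1 + d).
Proof. by rewrite /g_num (horner_map_pad _ _ r.-1) addrC addKr. Qed.

Lemma g_sum_of_fractions : (0 < m)%N -> (m <= r)%N ->
  is_sum_of_fractions (g_num a r) (g_den A r)
    (\sum_(d < size a) (a`_(r.-1 + d))%:MP * complete_homog (fun i : 'I_m => 'X_i) d).
Proof.
move=> m_gt0 le_mr; rewrite /is_sum_of_fractions.
under [RHS]eq_bigr do rewrite g_numE mulr_suml.
rewrite exchange_big mulr_sumr; apply: eq_bigr => d _.
under [RHS]eq_bigr do rewrite -mulrA; rewrite -mulr_sumr mulrCA; congr (_ * _).
rewrite big_split /= -mulrA -lagrange_sumE // /lagrange_sum mulr_sumr.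
apply: eq_bigr => i _; rewrite [in RHS]big_split /= !mulrA; congr (_ * _).
(* Here [x_i^(r-1+d)] is split as [x_i^(r-m) * x_i^(d+m-1)], which uses [0 < m <= r]. *)
rewrite (bigD1 i) //= mulrAC -exprD; congr ('X_i ^+ _ * _); lia.
Qed.
End Fractions.

(** * Pushforward of the powers of [H] *)

Section ProjectiveBundle.
Variables (T : chow_theory) (X : variety T) (E : bundle X) (rE : (0 < rank E)%N).

Let H := hclass rE.

Lemma codim_hclassX n : codim n (H ^+ n).
Proof.
elim: n => [|n IHn]; first exact: codim1.
by rewrite exprS -add1n; apply: codimM IHn; apply: chern_codim.
Qed.

Lemma push_hclassX_small n : (n < (rank E).-1)%N -> push (projm rE) (H ^+ n) = 0.
Proof.
move=> lt_n; apply: push_codim_small (codim_hclassX n).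
by rewrite dim_projb addnC ltn_add2l.
Qed.

Lemma hclass_relation :
  \sum_(i < (rank E).+1) pull (projm rE) (chern E i) * H ^+ (rank E - i) = 0.
Proof.
have [Q exQ] := taut_sub rE.
have rankQ : (rank Q).+1 = rank E by have := rank_exact exQ; rewrite rank_pullb rank_taut.
have chern_taut : chern (taut rE) 1 = - H.
  by rewrite /H /hclass chern_dualb expr1 mulN1r opprK.
pose q i := chern Q i.
have chernE n : pull (projm rE) (chern E n.+1) = q n.+1 - H * q n.
  rewrite -chern_pullb (whitney _ exQ) !big_ord_recl big1 ?addr0 /= => [|i _].
    by rewrite chern0 mul1r chern_taut mulNr subn0 subSS subn0.
  by rewrite chern_large ?mul0r // rank_taut.
rewrite -rankQ big_ord_recl /= chern0 rmorph1 mul1r.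
(* As [c(pi^*E) = (1 - H) c(Q)], the terms of positive index telescope to [- H^r], since [q]
   vanishes past [rank Q]; this cancels the term of index 0. *)
pose g i := q i * H ^+ ((rank Q).+1 - i).
rewrite (eq_bigr (fun i : 'I_(rank Q).+1 => g i.+1 - g i)) => [|i _].
  rewrite -(big_mkord xpredT (fun i => g i.+1 - g i)) telescope_sumr // /g /q.
  by rewrite chern_large // chern0 mul0r mul1r sub0r subn0 addrN.
by rewrite chernE mulrBl /g subSS subSn -1?ltnS // exprS mulrCA mulrA.
Qed.

(** The relation for [H], multiplied by [H^n] and pushed forward, is the recurrence; it is read in
    [B], where the Chern roots live. *)
Lemma push_hclassX (B : comNzRingType) (iota : {rmorphism chow X -> B}) u d :
    inverse_series (fun i => iota (chern E i)) u ->
  iota (push (projm rE) (H ^+ (d + (rank E).-1))) = u d.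
Proof.
move=> cu; rewrite -[RHS]mul1r.
apply: (@recurrence_solution _ (rank E) (fun i => iota (chern E i))
  (fun n => iota (push (projm rE) (H ^+ n)))) => //.
- by rewrite chern0 rmorph1.
- by move=> i lt_i; rewrite chern_large ?rmorph0.
- by move=> n lt_n; rewrite push_hclassX_small ?rmorph0.
- by rewrite push_top rmorph1.
move=> n; transitivity (iota (push (projm rE) (H ^+ n *
    \sum_(i < (rank E).+1) pull (projm rE) (chern E i) * H ^+ (rank E - i)))).
  rewrite mulr_sumr !raddf_sum /=; apply: eq_bigr => i _.
  by rewrite mulrCA -exprD projection_formula rmorphM.
by rewrite hclass_relation mulr0 !raddf0.
Qed.
End ProjectiveBundle.

(** Used with [z = 0] and [F l = 1 + l t]: zero roots contribute 1, and equal nonzero roots are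
    grouped into powers. *)
Lemma prod_multiplicity (B : choiceType) (R : comNzRingType) (z : B) (F : B -> R) (s : seq B)
    m (L : 'I_m -> B) (k : 'I_m -> nat) :
    F z = 1 -> injective L -> (forall l, (l \in s /\ l != z) <-> exists i, L i = l) ->
    (forall i, count_mem (L i) s = k i) ->
  \prod_(l <- s) F l = \prod_i F (L i) ^+ k i.
Proof.
move=> Fz L_inj LP kP; rewrite -prodr_undup_exp_count (bigID (pred1 z)) /=.
rewrite big1 ?mul1r => [|l /eqP->]; last by rewrite Fz expr1n.
rewrite -big_filter (perm_big [seq L i | i <- enum 'I_m]) /=.
  by rewrite big_map big_enum; apply: eq_bigr => i _; rewrite kP.
apply: uniq_perm; rewrite ?filter_uniq ?undup_uniq ?map_inj_uniq // -?enumT ?enum_uniq // => l.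
rewrite mem_filter mem_undup; apply/andP/mapP => [[l_nz l_s]|[i _ ->]].
  by have /LP[i <-] := conj l_s l_nz; exists i; rewrite ?mem_enum.
by have /LP[] : exists j, L j = L i by exists i.
Qed.

Theorem theorem4p1
    (T : chow_theory) (X : variety T) (E : bundle X) (rE : (0 < rank E)%N)
    (B : comNzRingType) (iota : {rmorphism chow X -> B}) (iota_inj : injective iota)
    (lambda : (rank E).-tuple B) (lambdaP : chern_roots iota lambda)
    (lambda_neq0 : exists2 l, l \in lambda & l != 0)
    (m : nat) (L : 'I_m -> B) (L_inj : injective L)
    (LP : forall l, (l \in lambda /\ l != 0) <-> exists i, L i = l)
    (k : 'X_{1..m}) (kP : forall i, count_mem (L i) lambda = (k i).+1)
    (alpha : chow (projb rE)) (a : {poly chow X})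
    (alphaP : alpha = (map_poly (pull (projm rE)) a).[hclass rE]) :
  exists S : {mpoly (chow X)[m]},
    unique (is_sum_of_fractions (g_num a (rank E)) (g_den _ (rank E))) S /\
    iota (push (projm rE) alpha) = (map_mpoly iota (Dop k S)).@[fun i => - L i].
Proof.
have L_in i : L i \in lambda /\ L i != 0 by apply/LP; exists i.
have m_gt0 : (0 < m)%N.
  by have [l l_in l_nz] := lambda_neq0; have /LP[[i lt_im] _] := conj l_in l_nz; case: (m) lt_im.
have le_m : (m <= rank E)%N.
  rewrite -(size_tuple lambda) -(size_enum_ord m) -(size_map L) uniq_leq_size //.
    by rewrite map_inj_uniq ?enum_uniq.
  by move=> _ /mapP[i _ ->]; have [] := L_in i.
have S_frac := g_sum_of_fractions a m_gt0 le_m.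
exists (\sum_(d < size a) (a`_((rank E).-1 + d))%:MP * complete_homog (fun i => 'X_i) d).
split.
  (* The common denominator is regular even if [chow X] has zero divisors, so it can be
     cancelled. *)
  by split=> // S' S'_frac; apply: (@lreg_prod_g_den _ _ (rank E)); rewrite S_frac S'_frac.
(* These are the coefficients of [1 / c_t(E)], and also [D] applied to the complete homogeneous
   polynomials, evaluated at [x_i = - L_i]. *)
pose u := cauchy_prod (fun i n => (- L i) ^+ n *+ 'C(n + k i, k i)).
have chern_inv : inverse_series (fun i => iota (chern E i)) u.
  have coefE i : iota (chern E i) = (\prod_i (1 + L i *: 'X) ^+ (k i).+1 : {poly B})`_i.
    rewrite -(@prod_multiplicity _ _ 0 (fun l => 1 + l *: 'X) lambda) //.
      rewrite -lambdaP coef_map coef_poly ltnS.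
      by case: leqP => // lt_i; rewrite chern_large // rmorph0.
    by rewrite scale0r addr0.
  move=> d; under eq_bigr do rewrite coefE.
  by apply: inverse_cauchy_prod => i; apply: inverse_negbinomial.
rewrite alphaP (horner_map_pad _ _ (rank E).-1) 2!raddfD 4!raddf_sum /=.
(* The terms of degree below [r - 1], subtracted in [g_num], are those that the pushforward
   kills. *)
rewrite [X in X + _]big1 ?add0r => [|i _].
  rewrite Dop_sum (rmorph_sum (map_mpoly iota)) (rmorph_sum (meval _)) /=; apply: eq_bigr => d _.
  rewrite DopCM Dop_complete_homog projection_formula addnC rmorphM.
  rewrite (push_hclassX _ _ chern_inv) !rmorphM /= map_mpolyC mevalC; congr (_ * _).
  rewrite !rmorph_cauchy_prod; apply: eq_cauchy_prod => i n.
  by rewrite !rmorphMn !rmorphXn /= map_mpolyX mevalXU.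
by rewrite projection_formula push_hclassX_small ?mulr0 ?rmorph0.
Qed.
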